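(* Let $k$ be a field, let $F=(F_1,\ldots,F_n)\in k[X_1,\ldots,X_n]^n$ be a polynomial endomorphism of the form $F=I-H$, where $I=(X_1,\ldots,X_n)$ and $H$ has affine part zero, and let $f=(f_1,\ldots,f_n)\in k[t]^n$ be a curve with $f(0)=0$. Let $B$ be the reduced Gröbner basis of the ideal $(F-f):=(F_1-f_1,\ldots,F_n-f_n)$ of $k[t][X_1,\ldots,X_n]$ with respect to an ordering where $t^m<X_i$ for each $m\in\mathbb{N}$, $1\le i\le n$. For $g=(g_1,\ldots,g_n)\in k[t]^n$ with $g(0)=0$, let $(X-g):=(X_1-g_1,\ldots,X_n-g_n)$ be the corresponding ideal of $k[t][X_1,\ldots,X_n]$. Then: (1) $B=(X_1-g_1,\ldots,X_n-g_n)$ (i.e. $B$ consists of the elements $X_1-g_1,\ldots,X_n-g_n$) if and only if $(F-f)=(X-g)$. In particular, if $F$ is an automorphism, then $B$ is of the said form. (2) If $F(g)=f$, then $B\subseteq (X-g)$. Hence, a curve $g$ such that $F(g)=f$ can, if it exists, be found by finding an ideal $(X-g)\supseteq B$.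
   Context: For $F\in k[X_1,\ldots,X_n]^n$ and $g\in k[t]^n$, $F(g)\in k[t]^n$ denotes the result of substituting $X_i:=g_i$ in every component of $F$. ''$H$ has affine part zero'' means that the components of $H$ have no constant and no linear terms. $F$ is an automorphism if it has a polynomial inverse, i.e. there is $G\in k[X_1,\ldots,X_n]^n$ with $F(G)=G(F)=(X_1,\ldots,X_n)$. *)

(* Defs.v *)
From mathcomp Require Import all_boot all_order all_algebra.
From mathcomp Require Import finmap.
From mathcomp Require Import mpoly.

Set Implicit Arguments.
Unset Strict Implicit.
Unset Printing Implicit Defensive.

Import GRing.Theory.
Local Open Scope ring_scope.

Section Ideals.
Variables (A : comNzRingType) (r : nat).

Definition in_ideal (gens : r.-tuple A) (p : A) : Prop :=
  exists c : 'I_r -> A, p = \sum_(i < r) c i * tnth gens i.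

End Ideals.

Section Maps.
Variables (k : fieldType) (n : nat).

(* No constant and no linear terms. *)
Definition affine_part_zero (H : n.-tuple {mpoly k[n]}) : Prop :=
  forall (i : 'I_n) (m : 'X_{1..n}), (mdeg m <= 1)%N -> (tnth H i)@_m = 0.

Definition idmap : n.-tuple {mpoly k[n]} := [tuple 'X_i | i < n].

Definition comp_map (F G : n.-tuple {mpoly k[n]}) : n.-tuple {mpoly k[n]} :=
  [tuple tnth F i \mPo G | i < n].

Definition is_automorphism (F : n.-tuple {mpoly k[n]}) : Prop :=
  exists G : n.-tuple {mpoly k[n]},
    comp_map F G = idmap /\ comp_map G F = idmap.

Definition vanishes_at0 (g : n.-tuple {poly k}) : Prop :=
  forall i : 'I_n, (tnth g i).[0] = 0.

(* The inclusion k[X_1..X_n] -> k[t][X_1..X_n]. *)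
Definition ext_t (p : {mpoly k[n]}) : {mpoly {poly k}[n]} := map_mpoly polyC p.

(* F(g) *)
Definition subst_curve (F : n.-tuple {mpoly k[n]}) (g : n.-tuple {poly k}) :
    n.-tuple {poly k} :=
  [tuple (ext_t (tnth F i)).@[tnth g] | i < n].

(* (F_1 - f_1, ..., F_n - f_n) *)
Definition map_sub_curve (F : n.-tuple {mpoly k[n]}) (f : n.-tuple {poly k}) :
    n.-tuple {mpoly {poly k}[n]} :=
  [tuple ext_t (tnth F i) - (tnth f i)%:MP | i < n].

(* (X_1 - g_1, ..., X_n - g_n) *)
Definition X_sub_curve (g : n.-tuple {poly k}) : n.-tuple {mpoly {poly k}[n]} :=
  [tuple 'X_i - (tnth g i)%:MP | i < n].

End Maps.

(* Groebner bases in k[t][X_1..X_n] are taken over the field k, viewing it as  *)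
(* the polynomial ring in the n + 1 variables t, X_1, ..., X_n: the pair       *)
(* (a, m) stands for the monomial t^a X^m.                                     *)
Section Groebner.
Variables (k : fieldType) (n : nat).

Definition tmon : Type := (nat * 'X_{1..n})%type.

Definition tmon_mul (u v : tmon) : tmon := ((u.1 + v.1)%N, (u.2 + v.2)%MM).

Definition tmon_dvd (u v : tmon) : bool := (u.1 <= v.1)%N && (u.2 <= v.2)%MM.

Definition tcoef (p : {mpoly {poly k}[n]}) (u : tmon) : k := (p@_(u.2))`_(u.1).

Record monomial_order (lt : rel tmon) : Prop := {
  mo_irr : irreflexive lt;
  mo_trans : transitive lt;
  mo_total : forall u v, u != v -> lt u v || lt v u;
  mo_mul : forall u v w, lt u v -> lt (tmon_mul u w) (tmon_mul v w);
  mo_wf : well_founded lt }.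

Definition t_below_X (lt : rel tmon) : Prop :=
  forall (a : nat) (i : 'I_n), lt (a, 0%MM) (0%N, U_(i)%MM).

Definition is_lead (lt : rel tmon) (p : {mpoly {poly k}[n]}) (u : tmon) : Prop :=
  tcoef p u != 0 /\ forall v, tcoef p v != 0 -> v != u -> lt v u.

Record groebner_basis (lt : rel tmon) (I : {mpoly {poly k}[n]} -> Prop)
    (B : {fset {mpoly {poly k}[n]}}) : Prop := {
  gb_sub : forall b, b \in B -> I b;
  gb_neq0 : forall b, b \in B -> b != 0;
  gb_lead : forall p u, I p -> is_lead lt p u ->
    exists2 b, b \in B & exists2 v, is_lead lt b v & tmon_dvd v u }.

Record reduced_groebner_basis (lt : rel tmon) (I : {mpoly {poly k}[n]} -> Prop)
    (B : {fset {mpoly {poly k}[n]}}) : Prop := {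
  rgb_gb : groebner_basis lt I B;
  rgb_lead1 : forall b u, b \in B -> is_lead lt b u -> tcoef b u = 1;
  rgb_red : forall b b' u v, b \in B -> b' \in B -> b' != b ->
    tcoef b u != 0 -> is_lead lt b' v -> ~~ tmon_dvd v u }.

End Groebner.

(* Main.v *)
(* Membership in (X - g) is vanishing at X = g, so F(g) = f says exactly that
   (F - f) is contained in (X - g); the division algorithm by B, which terminates
   as the monomial order is well-founded, transfers such inclusions between B
   and (F - f).  Since every power of t is below every X_i, a nonzero polynomial
   led by a power of t lies in k[t] and cannot vanish at a curve.  Hence all
   leading monomials of (X - g) are multiples of some X_i, and reducedness
   forces B to consist of the X_i - g_i.  If G is the inverse of F, then
   g = G(f) works, because G_i(F) = X_i is congruent to G_i(f) modulo F - f. *)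
Require Import Defs.
From mathcomp Require Import all_boot all_order all_algebra.
From mathcomp Require Import finmap.
From mathcomp Require Import mpoly.

Import GRing.Theory.
Local Open Scope ring_scope.

(** * Ideals, and congruence modulo an ideal *)

Lemma in_ideal0 (A : comNzRingType) (r : nat) (gens : r.-tuple A) :
  in_ideal gens 0.
Proof. by exists (fun=> 0); rewrite big1 // => i _; rewrite mul0r. Qed.

Lemma in_ideal_lin (A : comNzRingType) (r : nat) (gens : r.-tuple A) (a p q : A) :
  in_ideal gens p -> in_ideal gens q -> in_ideal gens (a * p + q).
Proof.
move=> [c ->] [d ->]; exists (fun i => a * c i + d i).
rewrite mulr_sumr -big_split; apply: eq_bigr => i _ /=.
by rewrite mulrDl mulrA.
Qed.

Lemma in_ideal_gen (A : comNzRingType) (r : nat) (gens : r.-tuple A) (i : 'I_r) :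
  in_ideal gens (tnth gens i).
Proof.
exists (fun j => (j == i)%:R).
rewrite (bigD1 i) //= eqxx mul1r big1 ?addr0 // => j /negPf->.
by rewrite mul0r.
Qed.

Lemma in_idealD (A : comNzRingType) (r : nat) (gens : r.-tuple A) (p q : A) :
  in_ideal gens p -> in_ideal gens q -> in_ideal gens (p + q).
Proof. by move=> Ip Iq; rewrite -[p]mul1r; apply: in_ideal_lin. Qed.

Lemma in_idealM (A : comNzRingType) (r : nat) (gens : r.-tuple A) (a p : A) :
  in_ideal gens p -> in_ideal gens (a * p).
Proof.
by move=> Ip; rewrite -[_ * _]addr0; apply: in_ideal_lin => //; apply: in_ideal0.
Qed.

Lemma in_ideal_sub (A : comNzRingType) (r s : nat) (gens : r.-tuple A)
    (gens' : s.-tuple A) (p : A) :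
  (forall i, in_ideal gens' (tnth gens i)) -> in_ideal gens p -> in_ideal gens' p.
Proof.
move=> sub [c ->]; elim/big_ind: _ => [|x y|i _]; first exact: in_ideal0.
- exact: in_idealD.
- exact: in_idealM.
Qed.

Lemma in_ideal_subM (A : comNzRingType) (r : nat) (gens : r.-tuple A)
    (x y z w : A) :
  in_ideal gens (x - y) -> in_ideal gens (z - w) ->
  in_ideal gens (x * z - y * w).
Proof.
move=> Ixy Izw.
have -> : x * z - y * w = z * (x - y) + y * (z - w).
  by rewrite !mulrBr mulrC [y * z]mulrC addrA subrK.
exact: in_ideal_lin (in_idealM _ _ _ _ _ Izw).
Qed.

Lemma in_ideal_subX (A : comNzRingType) (r : nat) (gens : r.-tuple A)
    (x y : A) (e : nat) :
  in_ideal gens (x - y) -> in_ideal gens (x ^+ e - y ^+ e).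
Proof. by move=> Ixy; rewrite subrXX mulrC; apply: in_idealM. Qed.

(** Congruence modulo an ideal respects sums, products and powers, hence evaluation at congruent
    points. *)
Lemma in_ideal_mmapB (R : nzRingType) (A : comNzRingType) (r n : nat)
    (gens : r.-tuple A) (c : R -> A) (h1 h2 : 'I_n -> A) (p : {mpoly R[n]}) :
  (forall i, in_ideal gens (h1 i - h2 i)) ->
  in_ideal gens (mmap c h1 p - mmap c h2 p).
Proof.
move=> Ih; rewrite /mmap -sumrB.
elim/big_ind: _ => [|x y|m _]; [exact: in_ideal0|exact: in_idealD|].
rewrite -mulrBr; apply: in_idealM; rewrite /mmap1.
elim/big_ind2: _ => [|x1 x2 y1 y2|i _].
- by rewrite subrr; apply: in_ideal0.
- exact: in_ideal_subM.
- exact: in_ideal_subX.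
Qed.

Lemma rmorph_mmap (R : nzRingType) (S T : comNzRingType) (n : nat)
    (phi : {rmorphism S -> T}) (c : R -> S) (h : 'I_n -> S) (p : {mpoly R[n]}) :
  phi (mmap c h p) = mmap (phi \o c) (phi \o h) p.
Proof.
rewrite /mmap raddf_sum; apply: eq_bigr => m _ /=.
rewrite rmorphM rmorph_prod; congr (_ * _).
by apply: eq_bigr => i _; rewrite rmorphXn.
Qed.

Lemma eq_mmap (R S : nzRingType) (n : nat) (c1 c2 : R -> S) (h1 h2 : 'I_n -> S)
    (p : {mpoly R[n]}) :
  c1 =1 c2 -> h1 =1 h2 -> mmap c1 h1 p = mmap c2 h2 p.
Proof.
by move=> eq_c eq_h; apply: eq_bigr => m _; rewrite eq_c (mmap1_eq _ eq_h).
Qed.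

Lemma mnm_neq0P (n : nat) (m : 'X_{1..n}) : m != 0%MM -> exists i, m i != 0%N.
Proof.
move=> m_neq0; apply/existsP; apply: contra_neqT m_neq0 => /existsPn m0.
by apply/mnmP => j; rewrite mnm0E; apply/eqP; have := m0 j; rewrite negbK.
Qed.

(** * Curves and the ideals [(X - g)] and [(F - f)] *)

Section Curves.
Variables (k : fieldType) (n : nat).
Implicit Types (F G H : n.-tuple {mpoly k[n]}) (f g : n.-tuple {poly k}).

Lemma meval_ext_t (p : {mpoly k[n]}) (v : 'I_n -> {poly k}) :
  (ext_t p).@[v] = mmap polyC v p.
Proof.
rewrite /ext_t /map_mpoly rmorph_mmap; apply: eq_mmap => [c|i] /=.
- by rewrite mevalC.
- by rewrite mevalXU.
Qed.

Lemma in_ideal_X_sub_curveP g (p : {mpoly {poly k}[n]}) :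
  in_ideal (X_sub_curve g) p <-> p.@[tnth g] = 0.
Proof.
split=> [[c ->]|pg0].
  rewrite raddf_sum big1 // => i _ /=.
  by rewrite tnth_mktuple mevalM mevalB mevalXU mevalC subrr mulr0.
(* The same polynomial evaluated at [X] and at [g]: the first value is [p], the second is zero, and
   the two points are congruent modulo [(X - g)]. *)
have -> : p = mmap (@mpolyC n _) (fun i => 'X_i) p
            - mmap (@mpolyC n _) (fun i => (tnth g i)%:MP) p.
  have -> : mmap (@mpolyC n _) (fun i => (tnth g i)%:MP) p = (p.@[tnth g])%:MP.
    by rewrite /meval rmorph_mmap.
  rewrite pg0 mpolyC0 subr0 -[LHS]comp_mpoly_id /comp_mpoly.
  by apply: eq_mmap => // i; rewrite tnth_mktuple.
apply: in_ideal_mmapB => i.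
by have := in_ideal_gen _ _ (X_sub_curve g) i; rewrite tnth_mktuple.
Qed.

Lemma meval_map_sub_curve F f g i :
  (tnth (map_sub_curve F f) i).@[tnth g] =
  tnth (subst_curve F g) i - tnth f i.
Proof. by rewrite !tnth_mktuple mevalB mevalC. Qed.

Lemma subst_curveP F f g :
  subst_curve F g = f <->
  forall p, in_ideal (map_sub_curve F f) p -> in_ideal (X_sub_curve g) p.
Proof.
split=> [Fg p|sub].
  apply: in_ideal_sub => i; apply/in_ideal_X_sub_curveP.
  by rewrite meval_map_sub_curve Fg subrr.
apply: eq_from_tnth => i; apply/eqP; rewrite -subr_eq0 -meval_map_sub_curve.
exact/eqP/in_ideal_X_sub_curveP/sub/in_ideal_gen.
Qed.

Lemma subst_curve_comp F G f :
  subst_curve F (subst_curve G f) = subst_curve (comp_map F G) f.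
Proof.
apply: eq_from_tnth => i; rewrite !tnth_mktuple !meval_ext_t.
rewrite /comp_mpoly rmorph_mmap; apply: eq_mmap => [c|j] /=.
- by rewrite mmapC.
- by rewrite tnth_mktuple meval_ext_t.
Qed.

Lemma subst_curve_id f : subst_curve (idmap k n) f = f.
Proof.
apply: eq_from_tnth => i; rewrite !tnth_mktuple meval_ext_t.
by rewrite mmapX mmap1U.
Qed.

Lemma left_inverse_curve_in_ideal F G f i :
  comp_map G F = idmap k n ->
  in_ideal (map_sub_curve F f) (tnth (X_sub_curve (subst_curve G f)) i).
Proof.
move=> GF; rewrite !tnth_mktuple meval_ext_t.
have -> : 'X_i = ext_t 'X_i :> {mpoly {poly k}[n]}.
  by rewrite /ext_t map_mpolyX.
have -> : 'X_i = tnth G i \mPo F.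
  by have /(congr1 (fun T => tnth T i)) := GF; rewrite !tnth_mktuple.
rewrite /ext_t /comp_mpoly !rmorph_mmap.
(* Both terms are now evaluations of [tnth G i], at [F] and at [f]; once the coefficient embeddings
   agree, congruence of the points suffices. *)
rewrite -(eq_mmap _ _ _ (@mpolyC n {poly k} \o polyC) _ (map_mpoly polyC \o tnth F)) //.
  apply: in_ideal_mmapB => j /=.
  by have := in_ideal_gen _ _ (map_sub_curve F f) j; rewrite tnth_mktuple.
by move=> c; rewrite /= map_mpolyC.
Qed.

Lemma meval0_affine_part_zero H i :
  affine_part_zero H -> (tnth H i).@[fun=> 0] = 0.
Proof.
move=> HH; rewrite mevalE big1 // => m _.
have [->|m_neq0] := eqVneq m 0%MM; first by rewrite HH ?mdeg0 ?mul0r.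
have [j mj] := mnm_neq0P _ _ m_neq0.
by rewrite (bigD1 j) //= expr0n (negPf mj) mul0r mulr0.
Qed.

(** Since [f(0) = 0], the value of [G(f)] at 0 is [G(0)]; and [F(0) = 0], so
    [G(0) = G(F(0)) = 0]. *)
Lemma left_inverse_vanishes_at0 F G H f :
  (forall i, tnth F i = 'X_i - tnth H i) -> affine_part_zero H ->
  vanishes_at0 f -> comp_map G F = idmap k n ->
  vanishes_at0 (subst_curve G f).
Proof.
move=> HF HH Hf GF i; rewrite tnth_mktuple meval_ext_t.
have -> : (mmap polyC (tnth f) (tnth G i)).[0] = (tnth G i).@[fun=> 0].
  rewrite -horner_evalE rmorph_mmap; apply: eq_mmap => [c|j] /=.
  - by rewrite horner_evalE hornerC.
  - exact: Hf.
have /(congr1 (fun T => (tnth T i).@[fun=> 0])) := GF.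
rewrite !tnth_mktuple mevalXU comp_mpoly_meval => GF0.
rewrite -[RHS]GF0; apply: meval_eq => j.
by rewrite HF mevalB mevalXU meval0_affine_part_zero // subrr.
Qed.

End Curves.

(** * Leading monomials and division over [k] *)

Section MonomialOrder.
Variables (k : fieldType) (n : nat) (lt : rel (tmon n)).
Hypothesis lt_mo : monomial_order lt.
Implicit Types (p q b : {mpoly {poly k}[n]}) (u v w : tmon n).

Let lt_irr := mo_irr lt_mo.
Let lt_trans := mo_trans lt_mo.

Lemma tcoefD p q u : tcoef (p + q) u = tcoef p u + tcoef q u.
Proof. by rewrite /tcoef mcoeffD coefD. Qed.

Lemma tcoef_eq0 p : (forall u, tcoef p u = 0) -> p = 0.
Proof.
move=> p0; apply/mpolyP => m; apply/polyP => a.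
by rewrite mcoeff0 coef0; apply: (p0 (a, m)).
Qed.

Lemma tmon_dvdP u v : reflect (exists w, v = tmon_mul u w) (tmon_dvd u v).
Proof.
apply: (iffP andP) => [[le1 le2]|[w ->]]; last first.
  by split; [apply: leq_addr|apply: lem_addr].
exists ((v.1 - u.1)%N, (v.2 - u.2)%MM).
by case: v le1 le2 => a m /= *; rewrite /tmon_mul /= subnKC // addmC submK.
Qed.

Definition tterm (c : k) u : {mpoly {poly k}[n]} := (c *: 'X^(u.1)) *: 'X_[u.2].

Lemma tcoef_tterm_mul c w p u :
  tcoef (tterm c w * p) (tmon_mul u w) = c * tcoef p u.
Proof.
rewrite /tcoef /tterm /tmon_mul /= -scalerAl mcoeffZ mulrC [(_ + _)%MM]addmC.
rewrite [_ * p]mulrC mcoeffMX mulrC -scalerAl coefZ mulrC coefXnM.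
by rewrite ltnNge leq_addl /= addnK mulrC.
Qed.

Lemma tcoef_tterm_mul_neq0 c w p v :
  tcoef (tterm c w * p) v != 0 ->
  exists2 u, v = tmon_mul u w & tcoef p u != 0.
Proof.
case: v w => a m [a' m']; rewrite /tcoef /tterm /= -scalerAl mcoeffZ.
rewrite [_ * p]mulrC; have [|/memN_msupp_eq0->] := boolP (m \in msupp (p * 'X_[m'])).
  rewrite (perm_mem (msuppMX _ _)) => /mapP[x _ ->].
  rewrite mcoeffMX -scalerAl coefZ coefXnM.
  case: ltnP => [_|le_a]; first by rewrite mulr0 eqxx.
  rewrite mulf_eq0 negb_or => /andP[_ px]; exists ((a - a')%N, x) => //.
  by rewrite /tmon_mul /= subnK // addmC.
by rewrite mulr0 coef0 eqxx.
Qed.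

Lemma exists_max_tmon (s : seq (tmon n)) :
  s != [::] -> exists2 u, u \in s & forall v, v \in s -> v != u -> lt v u.
Proof.
elim: s => // x s IHs _; have [->|/IHs[u us u_max]] := eqVneq s [::].
  exists x; rewrite ?mem_head // => v; rewrite inE => /eqP->.
  by rewrite eqxx.
have [xu|/(mo_total lt_mo)/orP[xu|ux]] := eqVneq x u.
- exists u; rewrite ?in_cons ?us ?orbT // => v.
  by rewrite in_cons xu => /orP[/eqP->|/u_max//]; rewrite eqxx.
- exists u; rewrite ?in_cons ?us ?orbT // => v.
  by rewrite in_cons => /orP[/eqP->|/u_max].
- exists x; rewrite ?mem_head // => v.
  rewrite in_cons => /orP[/eqP->|vs]; first by rewrite eqxx.
  by have [->//|/(u_max _ vs) vu _] := eqVneq v u; apply: lt_trans vu ux.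
Qed.

Lemma exists_lead p : p != 0 -> exists u, is_lead lt p u.
Proof.
move=> p_neq0.
(* A finite list of exactly the monomials of [p]: the exponents of [t] are bounded by the sizes of
   the coefficients. *)
pose s := [seq u <- [seq (a, m) : tmon n | m <- msupp p,
                                           a <- iota 0 (size p@_m)]
          | tcoef p u != 0].
have mem_s u : (u \in s) = (tcoef p u != 0).
  rewrite mem_filter andb_idr // => pu; case: u pu => a m pu.
  apply/allpairsPdep; exists m, a; split=> //.
    rewrite mcoeff_msupp; apply: contra_neq pu => pm.
    by rewrite /tcoef /= pm coef0.
  rewrite mem_iota ltnNge /=; apply: contraNN pu => le_pa.
  by rewrite /tcoef /= nth_default.
have /exists_max_tmon[u us u_max] : s != [::].
  apply: contra_neq p_neq0 => s0; apply: tcoef_eq0 => u.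
  by apply/eqP; rewrite -[_ == _]negbK -mem_s s0.
exists u; split; first by rewrite -mem_s.
by move=> v; rewrite -mem_s; apply: u_max.
Qed.

Lemma is_lead_uniq p u v : is_lead lt p u -> is_lead lt p v -> u = v.
Proof.
move=> [pu u_max] [pv v_max]; apply/eqP/negPn/negP => uv.
have := lt_trans _ _ _ (v_max _ pu uv) (u_max _ pv _).
by rewrite lt_irr eq_sym uv => /(_ isT).
Qed.

(** Division by [B]: subtracting a multiple of some [b] in [B] cancels the leading term and leaves a
    remainder in [I] with a smaller leading monomial, so well-founded induction applies. *)
Lemma groebner_basis_generates (I J : {mpoly {poly k}[n]} -> Prop)
    (B : {fset {mpoly {poly k}[n]}}) :
  (forall a p q, I p -> I q -> I (a * p + q)) ->
  (forall a p q, J p -> J q -> J (a * p + q)) -> J 0 ->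
  groebner_basis lt I B -> (forall b, b \in B -> J b) ->
  forall p, I p -> J p.
Proof.
move=> Ilin Jlin J0 GB BJ p Ip.
have [->//|/exists_lead[u pu]] := eqVneq p 0.
elim/(well_founded_ind (mo_wf lt_mo)): u => u IH in p Ip pu *.
have [b bB [v bv /tmon_dvdP[w def_u]]] := gb_lead GB Ip pu.
have [[p_u u_max] [b_v v_max]] := (pu, bv).
pose s := tterm (tcoef p u / tcoef b v) w; pose r := - s * b + p.
have def_p : p = s * b + r by rewrite /r mulNr addNKr.
have Ir : I r by apply: Ilin => //; apply: (gb_sub GB bB).
rewrite def_p; apply: Jlin; first exact: BJ.
have [->//|/exists_lead[x rx]] := eqVneq r 0.
apply: (IH x) => //; have [r_x _] := rx.
have r_u : tcoef r u = 0.
  apply: (addrI (tcoef (s * b) u)); rewrite -tcoefD -def_p addr0.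
  by rewrite {2}def_u tcoef_tterm_mul divfK.
have x_neq_u : x != u by apply: contraNneq r_x => ->; rewrite r_u.
have [p_x|/u_max->//] := eqVneq (tcoef p x) 0.
(* A monomial of [r] absent from [p] comes from [s * b], so it is [y * w] with [y] in [b]; here [y]
   differs from [v], hence [y < v] and [x < u]. *)
have : tcoef (s * b) x != 0.
  apply: contraNneq r_x => sb_x.
  by rewrite -[tcoef r x]add0r -{1}sb_x -tcoefD -def_p p_x.
move=> /tcoef_tterm_mul_neq0[y def_x b_y].
rewrite def_x def_u; apply: (mo_mul lt_mo); apply: v_max => //.
by apply: contra_neq x_neq_u => yv; rewrite def_x def_u yv.
Qed.

(** * Compatibility of the order with divisibility *)

Definition tmon1 : tmon n := (0%N, 0%MM).

Lemma tmon_mul1 u : tmon_mul tmon1 u = u.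
Proof. by case: u => a m; rewrite /tmon_mul /= add0n add0m. Qed.

(* Otherwise [w > w^2 > w^4 > ...] would contradict well-foundedness. *)
Lemma nlt_tmon1 w : ~~ lt w tmon1.
Proof.
elim/(well_founded_ind (mo_wf lt_mo)): w => w IH; apply/negP => w1.
have ww : lt (tmon_mul w w) w.
  by rewrite -{3}[w]tmon_mul1; apply: (mo_mul lt_mo).
by have /negP := IH _ ww; apply; apply: lt_trans ww w1.
Qed.

(** The cofactor is not 1, hence lies above 1; multiply by [u]. *)
Lemma lt_tmon_dvd u v : tmon_dvd u v -> u != v -> lt u v.
Proof.
move=> /tmon_dvdP[w ->]; have [->|w_neq1] := eqVneq w tmon1.
  by case: u => a m; rewrite /tmon_mul /= addn0 addm0 eqxx.
move=> _; have /orP[] := mo_total lt_mo w_neq1.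
  by rewrite (negPf (nlt_tmon1 w)).
move=> /(mo_mul lt_mo u); rewrite tmon_mul1.
by case: u w {w_neq1} => a m [a' m']; rewrite /tmon_mul /= addnC addmC.
Qed.

Definition tmonX (i : 'I_n) : tmon n := (0%N, U_(i)%MM).

Lemma tmonX_dvd i u : tmon_dvd (tmonX i) u = (u.2 i != 0%N).
Proof. exact: lep1mP. Qed.

Lemma tmon_dvd_tmonX u i : tmon_dvd u (tmonX i) -> u.2 != 0%MM -> u = tmonX i.
Proof.
case: u => a m /andP[/=]; rewrite leqn0 => /eqP-> /mnm_lepP le_m.
move=> /mnm_neq0P[j mj]; congr pair; apply/mnmP => l.
have ij : i = j.
  by apply: contraNeq mj => ij; have := le_m j; rewrite mnm1E (negPf ij) leqn0.
have := le_m l; rewrite mnm1E; case: eqP => [il|_]; last by rewrite leqn0 => /eqP.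
by rewrite -il ij; case: (m j) mj => [|[]].
Qed.

(** * Orders with all powers of [t] below the [X_i] *)

Hypothesis lt_tX : t_below_X lt.

Lemma is_lead_X_sub (g : {poly k}) i : is_lead lt ('X_i - g%:MP) (tmonX i).
Proof.
split=> [|[a m]]; rewrite /tcoef /= mcoeffB mcoeffC mcoeffX.
  by rewrite eqxx mnm1_eq0 mulr0 subr0 coef1 oner_eq0.
have [<-|_] := eqVneq U_(i)%MM m.
  by rewrite mnm1_eq0 mulr0 subr0 coef1; case: a => [|a]; rewrite ?eqxx.
have [-> _ _|_] := eqVneq m 0%MM; first exact: lt_tX.
by rewrite mulr0 subrr coef0 eqxx.
Qed.

Lemma lt_t_pow a u : u.2 != 0%MM -> lt (a, 0%MM) u.
Proof.
move=> /mnm_neq0P[i]; rewrite -tmonX_dvd => dvd_u.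
have [<-|/(lt_tmon_dvd _ _ dvd_u)] := eqVneq (tmonX i) u; first exact: lt_tX.
by apply: lt_trans; apply: lt_tX.
Qed.

Lemma lead_meval_neq0 p u (v : 'I_n -> {poly k}) :
  is_lead lt p u -> p.@[v] = 0 -> u.2 != 0%MM.
Proof.
move=> [p_u u_max] pv0; apply/eqP => u20.
(* A monomial involving some [X_i] would exceed the power of [t] that leads [p]; so [p] lies in
   [k[t]] and equals its own value at [v]. *)
have p_const : p = (p@_0)%:MP.
  apply/mpolyP => m; rewrite mcoeffC; have [->|m_neq0] := eqVneq m 0%MM.
    by rewrite mulr1.
  rewrite mulr0; apply/polyP => a; rewrite coef0; apply/eqP/negPn/negP => p_am.
  have lt_u : lt u (a, m).
    by case: u u20 {p_u u_max} => b mu /= ->; apply: lt_t_pow.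
  have := u_max (a, m) p_am; case: eqVneq => [am|_ /(_ isT) ltu].
    by rewrite am lt_irr in lt_u.
  by have := lt_trans _ _ _ lt_u ltu; rewrite lt_irr.
move: pv0; rewrite p_const mevalC => p0.
by move: p_u; rewrite p_const p0 mpolyC0 /tcoef mcoeff0 coef0 eqxx.
Qed.

Lemma reduced_groebner_basis_X_sub_curve (I : {mpoly {poly k}[n]} -> Prop)
    (g : n.-tuple {poly k}) (B : {fset {mpoly {poly k}[n]}}) :
  (forall p, I p <-> in_ideal (X_sub_curve g) p) ->
  reduced_groebner_basis lt I B -> B =i X_sub_curve g.
Proof.
move=> IE RB; have GB := rgb_gb RB.
have I0 p : I p -> p.@[tnth g] = 0 by move=> /IE/in_ideal_X_sub_curveP.
(* The leading monomial [X_i] of [X_i - g_i] has a divisor leading some [b] in [B]. As [b] vanishes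
   at [g], that divisor is not a power of [t], so it is [X_i] itself. *)
have X_lead i : exists2 b, b \in B & is_lead lt b (tmonX i).
  have Xg : I ('X_i - (tnth g i)%:MP).
    by apply/IE; have := in_ideal_gen _ _ (X_sub_curve g) i; rewrite tnth_mktuple.
  have [b bB [v bv dvd_v]] := gb_lead GB Xg (is_lead_X_sub (tnth g i) i).
  exists b => //; rewrite -(tmon_dvd_tmonX v) //.
  exact: lead_meval_neq0 bv (I0 _ (gb_sub GB bB)).
have XB i b : b \in B -> is_lead lt b (tmonX i) -> b = 'X_i - (tnth g i)%:MP.
  move=> bB bX; have [_ X_max] := bX.
  (* The other monomials of [b] are powers of [t]: a multiple of [X_i] would exceed the leading
     monomial, and a multiple of another [X_j] is divisible by the leading monomial of a different
     element of [B]. *)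
  have b_low u : tcoef b u != 0 -> u != tmonX i -> u.2 = 0%MM.
    move=> b_u uX; apply/eqP/negPn/negP => /mnm_neq0P[j].
    rewrite -tmonX_dvd; have [->|ji] := eqVneq j i.
      move=> /lt_tmon_dvd; rewrite eq_sym uX => /(_ isT) /lt_trans.
      by move=> /(_ _ (X_max _ b_u uX)); rewrite lt_irr.
    have [b' b'B b'X] := X_lead j; apply/negP.
    apply: (rgb_red RB bB b'B _ b_u b'X); apply: contra_neq ji => b'b.
    rewrite b'b in b'X; have /(congr1 (fun u : tmon n => u.2 j)) := is_lead_uniq _ _ _ b'X bX.
    by rewrite /= !mnm1E eqxx; case: eqP.
  have def_b : b = 'X_i + (b@_0)%:MP.
    apply/mpolyP => m; rewrite mcoeffD mcoeffX mcoeffC.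
    have [<-|mi] := eqVneq U_(i)%MM m.
      rewrite mnm1_eq0 mulr0 addr0; apply/polyP => -[|a].
        by rewrite coef1; apply: (rgb_lead1 RB bB bX).
      rewrite coef1 /=; apply/eqP/negPn/negP => b_a.
      have /eqP := b_low (a.+1, U_(i)%MM) b_a isT.
      by rewrite mnm1_eq0.
    rewrite add0r; have [->|m0] := eqVneq m 0%MM; first by rewrite mulr1.
    rewrite mulr0; apply/polyP => a; rewrite coef0.
    apply/eqP/negPn/negP => b_a; move/eqP: m0; apply.
    by apply: (b_low (a, m) b_a); apply: contra_neq mi => -[_ ->].
  (* Vanishing at [g] determines the remaining coefficient as [- g_i]. *)
  have := I0 _ (gb_sub GB bB); rewrite {1}def_b mevalD mevalXU mevalC.
  by move=> /eqP; rewrite addr_eq0 => /eqP->; rewrite mpolyCN opprK.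
move=> b; apply/idP/tnthP => [bB|[i ->]]; last first.
  have [b' b'B b'X] := X_lead i.
  by rewrite tnth_mktuple -(XB _ _ b'B b'X).
(* The leading monomial of [b] is a multiple of some [X_i], which leads an element [b'] of [B];
   reducedness forces [b = b']. *)
have /exists_lead[u bu] := gb_neq0 GB bB.
have /mnm_neq0P[i] := lead_meval_neq0 _ _ _ bu (I0 _ (gb_sub GB bB)).
rewrite -tmonX_dvd => dvd_u; exists i; rewrite tnth_mktuple.
have [b' b'B b'X] := X_lead i; rewrite -(XB _ _ b'B b'X).
apply/eqP/negPn/negP; rewrite eq_sym => b'b; have [b_u _] := bu.
by have /negP := rgb_red RB bB b'B b'b b_u b'X.
Qed.

End MonomialOrder.

Theorem theorem4p7 (k : fieldType) (n : nat)
    (F H : n.-tuple {mpoly k[n]}) (f : n.-tuple {poly k})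
    (lt : rel (tmon n)) (B : {fset {mpoly {poly k}[n]}})
    (HF : forall i : 'I_n, tnth F i = 'X_i - tnth H i)
    (HH : affine_part_zero H)
    (Hf : vanishes_at0 f)
    (Hlt : monomial_order lt)
    (HtX : t_below_X lt)
    (HB : reduced_groebner_basis lt (in_ideal (map_sub_curve F f)) B) :
  (* (1) *)
  (forall g : n.-tuple {poly k}, vanishes_at0 g ->
     (B =i X_sub_curve g <->
      (forall p, in_ideal (map_sub_curve F f) p <-> in_ideal (X_sub_curve g) p)))
  /\ (is_automorphism F ->
      exists g : n.-tuple {poly k}, vanishes_at0 g /\ B =i X_sub_curve g)
  (* (2) *)
  /\ (forall g : n.-tuple {poly k}, vanishes_at0 g -> subst_curve F g = f ->
        forall b, b \in B -> in_ideal (X_sub_curve g) b)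
  /\ ((exists g : n.-tuple {poly k}, vanishes_at0 g /\ subst_curve F g = f) ->
      exists g : n.-tuple {poly k}, vanishes_at0 g /\
        forall b, b \in B -> in_ideal (X_sub_curve g) b)
  /\ (forall g : n.-tuple {poly k}, vanishes_at0 g ->
        (forall b, b \in B -> in_ideal (X_sub_curve g) b) ->
        subst_curve F g = f).
Proof.
have GB := rgb_gb HB.
(* The converse is division by [B]: if [B] lies in [(X - g)], then so does all of [(F - f)]. *)
have part2 g : subst_curve F g = f <-> forall b, b \in B -> in_ideal (X_sub_curve g) b.
  split=> [/subst_curveP sub b bB|BJ]; first exact/sub/(gb_sub GB bB).
  apply/subst_curveP.
  apply: (groebner_basis_generates _ _ _ Hlt _ _ _ _ _ (in_ideal0 _ _ _) GB BJ);
    exact: in_ideal_lin.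
have eq_ideals g :
    (forall i, in_ideal (map_sub_curve F f) (tnth (X_sub_curve g) i)) ->
    subst_curve F g = f ->
    forall p, in_ideal (map_sub_curve F f) p <-> in_ideal (X_sub_curve g) p.
  by move=> Xg /subst_curveP sub p; split=> [/sub|/in_ideal_sub]; last exact.
split=> [g _|].
  split=> [BX|IE]; last exact: reduced_groebner_basis_X_sub_curve IE HB.
  apply: eq_ideals => [i|].
    by apply: (gb_sub GB); rewrite BX mem_tnth.
  by apply/part2 => b; rewrite BX => /tnthP[i ->]; apply: in_ideal_gen.
split=> [[G [FG GF]]|].
  (* [GF] yields the vanishing at 0 and puts each [X_i - g_i] in [(F - f)]; [FG] yields [F(g) = f],
     the opposite inclusion. *)
  exists (subst_curve G f); split.
    exact: left_inverse_vanishes_at0 HF HH Hf GF.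
  apply: reduced_groebner_basis_X_sub_curve HB => //; apply: eq_ideals => [i|].
    exact: left_inverse_curve_in_ideal.
  by rewrite subst_curve_comp FG subst_curve_id.
split=> [g _ /part2//|]; split=> [[g [g0 /part2 BX]]|g _ /part2//].
by exists g.
Qed.
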